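(* Let $A$ have trivial centre, $\Omega^1$ a central basis $\{s^i\}$, $\mathcal S$ a central basis $\{e^\alpha\}$, with quantum metric, bimodule connection $\nabla$ on $\Omega^1$ and bimodule connection $\nabla_{\mathcal S}$ on $\mathcal S$. The spinor Laplacian is given on $\psi=\psi_\alpha e^\alpha$ by $$(\square_{\mathcal S}\psi)_\alpha=\square\psi_\alpha+\psi_\beta L^\beta{}_\alpha+(\partial_i\psi_\beta)\,(g^{ij}+g^{kl}\sigma^{ij}{}_{kl})\,S^\beta{}_{j\alpha},$$ where, for all $a\in A$, $$\square a=(\ ,\ )\nabla((\partial_ja)s^j)=g^{ij}\partial_i\partial_ja-\tfrac12(\partial_ja)\,g^{kl}\,\Gamma^j{}_{kl},$$ $$L^\alpha{}_\beta=g^{ij}\partial_iS^\alpha{}_{j\beta}-\tfrac12S^\alpha{}_{j\beta}\,g^{kl}\,\Gamma^j{}_{kl}+g^{kl}\sigma^{ij}{}_{kl}\,S^\alpha{}_{i\gamma}S^\gamma{}_{j\beta}$$ are the scalar Laplacian and the coefficients defined by $\square_{\mathcal S}(e^\alpha)=L^\alpha{}_\beta e^\beta$, respectively (summation over repeated indices).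
   Context: $A$ is a unital algebra over $\mathbb{C}$ with centre $\mathbb{C}1$; $(\Omega^1,d)$ is a first order differential calculus ($\Omega^1$ an $A$-bimodule, $d(ab)=(da)b+a\,db$, $\Omega^1$ spanned by elements $a\,db$), free with a central basis $\{s^i\}$ ($as^i=s^ia$). Partial derivatives are defined by $da=(\partial_ia)s^i$. The quantum metric is $g=g_{ij}s^i\otimes s^j$ with inverse the bimodule map $(\ ,\ ):\Omega^1\otimes_A\Omega^1\to A$, $g^{ij}:=(s^i,s^j)\in\mathbb{C}$ (the inverse matrix to $g_{ij}$). A bimodule connection $\nabla:\Omega^1\to\Omega^1\otimes_A\Omega^1$ obeys $\nabla(a\omega)=a\nabla\omega+da\otimes\omega$, $\nabla(\omega a)=(\nabla\omega)a+\sigma(\omega\otimes da)$ with $\sigma$ a bimodule map; write $\nabla s^i=-\frac12\Gamma^i{}_{jk}s^j\otimes s^k$ with $\Gamma^i{}_{jk}\in A$ and $\sigma(s^i\otimes s^j)=\sigma^{ij}{}_{kl}s^k\otimes s^l$ with $\sigma^{ij}{}_{kl}\in\mathbb{C}$. $\mathcal S$ is an $A$-bimodule, free with central basis $\{e^\alpha\}$, with bimodule connection $\nabla_{\mathcal S}:\mathcal S\to\Omega^1\otimes_A\mathcal S$ (the same Leibniz rules, with a bimodule map $\sigma_{\mathcal S}:\mathcal S\otimes_A\Omega^1\to\Omega^1\otimes_A\mathcal S$), $\nabla_{\mathcal S}e^\alpha=S^\alpha{}_{i\beta}s^i\otimes e^\beta$, $S^\alpha{}_{i\beta}\in A$. The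 scalar Laplacian is $\square=(\ ,\ )\nabla d:A\to A$ and the spinor Laplacian is $\square_{\mathcal S}=((\ ,\ )\otimes\mathrm{id})\big(\nabla\otimes\mathrm{id}+(\sigma\otimes\mathrm{id})(\mathrm{id}\otimes\nabla_{\mathcal S})\big)\nabla_{\mathcal S}:\mathcal S\to\mathcal S$. *)

(* Defs.v *)
From HB Require Import structures.
From mathcomp Require Import all_boot all_order all_algebra.
From mathcomp Require Import boolp classical_sets.

Set Implicit Arguments.
Unset Strict Implicit.
Unset Printing Implicit Defensive.

Import GRing.Theory.
Local Open Scope ring_scope.
Local Open Scope quotient_scope.

(* The left action is the [lmodType] scaling [a *: x], the right action is
   [ract x a]; the last axiom says that the two induced actions of the ground
   ring [K] coincide. *)
HB.mixin Record isBimodule (K : comNzRingType) (A : algType K) M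
    of GRing.Lmodule A M := {
  ract : M -> A -> M;
  ractDl : forall a, {morph ract^~ a : x y / x + y};
  ractDr : forall x, {morph ract x : a b / a + b};
  ractA : forall x a b, ract (ract x a) b = ract x (a * b);
  ract1 : forall x, ract x 1 = x;
  scale_ract : forall a x b, a *: ract x b = ract (a *: x) b;
  ract_scalar : forall (k : K) x, ract x k%:A = k%:A *: x }.

#[short(type="bimodType")]
HB.structure Definition Bimodule (K : comNzRingType) (A : algType K) :=
  {M of GRing.Lmodule A M & isBimodule K A M}.

Arguments ract {K A s} _ _ : rename.

Section Regular.
Variables (K : comNzRingType) (A : algType K).

Fact regular_ract_scalar (k : K) (x : A^o) :
  (x : A) * k%:A = (k%:A : A) *: x.
Proof. by rewrite mulr_algr; exact: (esym (mulr_algl k x)). Qed.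

HB.instance Definition _ := isBimodule.Build K A A^o
  (fun a x y => mulrDl x y a) (fun x a b => mulrDr x a b)
  (fun x a b => esym (mulrA x a b)) (@mulr1 A)
  (fun a x b => mulrA a x b) regular_ract_scalar.
End Regular.

Definition bimodule_map (K : comNzRingType) (A : algType K)
    (M N : bimodType A) (f : M -> N) : Prop :=
  [/\ {morph f : x y / x + y},
      forall a x, f (a *: x) = a *: f x
    & forall x a, f (ract x a) = ract (f x) a].

Section Tensor.
Variables (K : comNzRingType) (A : algType K).

Definition balanced (M N : bimodType A) (G : zmodType) (f : M -> N -> G) :=
  [/\ forall y, {morph f^~ y : x x' / x + x'},
      forall x, {morph f x : y y' / y + y'}
    & forall x a y, f (ract x a) y = f x (a *: y)].

Section Construction.
Variables M N : bimodType A.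
Implicit Type s : seq (M * N).

Definition tsum (G : zmodType) (f : M -> N -> G) s : G :=
  \sum_(p <- s) f p.1 p.2.

(* A sequence of pairs [(x, y)] stands for the formal sum of the [x (x) y];
   two formal sums are identified when no balanced map into an abelian group
   separates them.  Negatives need not be added formally since
   [- (x (x) y) = (- x) (x) y]. *)
Definition tensor_eqv : rel (seq (M * N)) := fun s t =>
  `[< forall (G : zmodType) (f : M -> N -> G),
        balanced f -> tsum f s = tsum f t >].

Fact tensor_eqv_equiv : equiv_class_of tensor_eqv.
Proof.
split=> [s|s t|t s u].
- exact/asboolP.
- by apply/asboolP/asboolP=> H G f fb; rewrite H.
- move=> /asboolP H1 /asboolP H2; apply/asboolP=> G f fb.
  by rewrite H1 // H2.
Qed.

Canonical tensor_equiv := EquivRelPack tensor_eqv_equiv.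
Canonical tensor_encModRel := defaultEncModRel tensor_eqv.

Definition tensor := {eq_quot tensor_eqv}.
HB.instance Definition _ := Choice.on tensor.
HB.instance Definition _ : EqQuotient _ tensor_eqv tensor :=
  EqQuotient.on tensor.

Implicit Types t u : tensor.

Definition tpure (x : M) (y : N) : tensor := \pi_tensor [:: (x, y)].

(* The additive map on the tensor product induced by [f]; only meaningful when
   [f] is [balanced], see [tliftE]. *)
Definition tlift (G : zmodType) (f : M -> N -> G) (t : tensor) : G :=
  tsum f (repr t).

Definition tensor0 : tensor := \pi_tensor [::].
Definition tensor_add (t u : tensor) : tensor :=
  \pi_tensor (repr t ++ repr u).
Definition tensor_opp (t : tensor) : tensor :=
  \pi_tensor [seq (- p.1, p.2) | p <- repr t].
Definition tensor_scale (a : A) (t : tensor) : tensor :=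
  \pi_tensor [seq (a *: p.1, p.2) | p <- repr t].
Definition tensor_ract (t : tensor) (a : A) : tensor :=
  \pi_tensor [seq (p.1, ract p.2 a) | p <- repr t].

Lemma tensorP (t u : tensor) :
  (forall (G : zmodType) (f : M -> N -> G),
     balanced f -> tlift f t = tlift f u) -> t = u.
Proof.
move=> H; rewrite -[t]reprK -[u]reprK; apply/eqmodP/asboolP=> G f fb.
exact: H.
Qed.

Lemma tlift_pi (G : zmodType) (f : M -> N -> G) s :
  balanced f -> tlift f (\pi_tensor s) = tsum f s.
Proof.
move=> fb; rewrite /tlift.
have /eqmodP/asboolP -> // : repr (\pi_tensor s) = s %[mod tensor].
by rewrite reprK.
Qed.

Lemma tsum_cat (G : zmodType) (f : M -> N -> G) s s' :
  tsum f (s ++ s') = tsum f s + tsum f s'.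
Proof. by rewrite /tsum big_cat. Qed.

Lemma tsum_map (G : zmodType) (f : M -> N -> G) (h : M * N -> M * N) s :
  tsum f [seq h p | p <- s] = tsum (fun x y => f (h (x, y)).1 (h (x, y)).2) s.
Proof. by rewrite /tsum big_map; apply: eq_bigr => -[]. Qed.

Lemma balanced0l (G : zmodType) (f : M -> N -> G) y : balanced f -> f 0 y = 0.
Proof. by case=> fl _ _; apply: (addrI (f 0 y)); rewrite -fl !addr0. Qed.

Lemma balancedNl (G : zmodType) (f : M -> N -> G) x y :
  balanced f -> f (- x) y = - f x y.
Proof.
move=> fb; have [fl _ _] := fb; apply: (addrI (f x y)).
by have := fl y x (- x); rewrite !subrr balanced0l // => ->.
Qed.

Lemma balancedZ (G : zmodType) (f : M -> N -> G) a :
  balanced f -> balanced (fun x y => f (a *: x) y).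
Proof.
case=> fl fr fm; split=> [y x x'|x y y'|x b y].
- by rewrite scalerDr fl.
- by rewrite fr.
- by rewrite scale_ract fm.
Qed.

Lemma balancedR (G : zmodType) (f : M -> N -> G) a :
  balanced f -> balanced (fun x y => f x (ract y a)).
Proof.
case=> fl fr fm; split=> [y x x'|x y y'|x b y].
- by rewrite fl.
- by rewrite ractDl fr.
- by rewrite fm scale_ract.
Qed.

Lemma tlift0 (G : zmodType) (f : M -> N -> G) :
  balanced f -> tlift f tensor0 = 0.
Proof. by move=> fb; rewrite tlift_pi // /tsum big_nil. Qed.

Lemma tlift_add (G : zmodType) (f : M -> N -> G) t u :
  balanced f -> tlift f (tensor_add t u) = tlift f t + tlift f u.
Proof. by move=> fb; rewrite tlift_pi // tsum_cat. Qed.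

Lemma tlift_opp (G : zmodType) (f : M -> N -> G) t :
  balanced f -> tlift f (tensor_opp t) = - tlift f t.
Proof.
move=> fb; rewrite tlift_pi // tsum_map /tlift /tsum -sumrN.
by apply: eq_bigr => p _; rewrite balancedNl.
Qed.

Lemma tlift_scale (G : zmodType) (f : M -> N -> G) a t :
  balanced f ->
  tlift f (tensor_scale a t) = tlift (fun x y => f (a *: x) y) t.
Proof. by move=> fb; rewrite tlift_pi // tsum_map. Qed.

Lemma tlift_ract (G : zmodType) (f : M -> N -> G) a t :
  balanced f ->
  tlift f (tensor_ract t a) = tlift (fun x y => f x (ract y a)) t.
Proof. by move=> fb; rewrite tlift_pi // tsum_map. Qed.

Fact tensor_addA : associative tensor_add.
Proof. by move=> t u v; apply: tensorP => G f fb; rewrite !tlift_add // addrA. Qed.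
Fact tensor_addC : commutative tensor_add.
Proof. by move=> t u; apply: tensorP => G f fb; rewrite !tlift_add // addrC. Qed.
Fact tensor_add0 : left_id tensor0 tensor_add.
Proof. by move=> t; apply: tensorP => G f fb; rewrite tlift_add // tlift0 // add0r. Qed.
Fact tensor_addN : left_inverse tensor0 tensor_opp tensor_add.
Proof.
move=> t; apply: tensorP => G f fb.
by rewrite tlift_add // tlift_opp // tlift0 // addNr.
Qed.

HB.instance Definition _ := GRing.isZmodule.Build tensor
  tensor_addA tensor_addC tensor_add0 tensor_addN.

Fact tensor_scaleA a b t :
  tensor_scale a (tensor_scale b t) = tensor_scale (a * b) t.
Proof.
apply: tensorP => G f fb; rewrite !tlift_scale //; last exact: balancedZ.
by apply: eq_bigr => p _; rewrite scalerA.
Qed.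
Fact tensor_scale1 : left_id 1 tensor_scale.
Proof.
move=> t; apply: tensorP => G f fb; rewrite tlift_scale //.
by apply: eq_bigr => p _; rewrite scale1r.
Qed.
Fact tensor_scaleDr : right_distributive tensor_scale +%R.
Proof.
move=> a t u; apply: tensorP => G f fb.
rewrite tlift_scale // !tlift_add ?tlift_scale //.
exact: balancedZ.
Qed.
Fact tensor_scaleDl t : {morph tensor_scale^~ t : a b / a + b}.
Proof.
move=> a b; apply: tensorP => G f fb.
rewrite tlift_add // !tlift_scale // /tlift /tsum -big_split /=.
by apply: eq_bigr => p _; have [fl _ _] := fb; rewrite scalerDl fl.
Qed.

HB.instance Definition _ := GRing.Zmodule_isLmodule.Build A tensor
  tensor_scaleA tensor_scale1 tensor_scaleDr tensor_scaleDl.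

Fact tensor_ractDl a : {morph tensor_ract^~ a : t u / t + u}.
Proof.
move=> t u; apply: tensorP => G f fb.
rewrite tlift_ract // !tlift_add ?tlift_ract //.
exact: balancedR.
Qed.
Fact tensor_ractDr t : {morph tensor_ract t : a b / a + b}.
Proof.
move=> a b; apply: tensorP => G f fb.
rewrite tlift_add // !tlift_ract // /tlift /tsum -big_split /=.
by apply: eq_bigr => p _; have [_ fr _] := fb; rewrite ractDr fr.
Qed.
Fact tensor_ractA t a b :
  tensor_ract (tensor_ract t a) b = tensor_ract t (a * b).
Proof.
apply: tensorP => G f fb; rewrite !tlift_ract //; last exact: balancedR.
by apply: eq_bigr => p _; rewrite ractA.
Qed.
Fact tensor_ract1 t : tensor_ract t 1 = t.
Proof.
apply: tensorP => G f fb; rewrite tlift_ract //.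
by apply: eq_bigr => p _; rewrite ract1.
Qed.
Fact tensor_scale_ract a t b :
  a *: tensor_ract t b = tensor_ract (a *: t) b.
Proof.
apply: tensorP => G f fb; rewrite [LHS]tlift_scale // tlift_ract //.
  by rewrite [RHS]tlift_ract // tlift_scale //; exact: balancedR.
exact: balancedZ.
Qed.
Fact tensor_ract_scalar (k : K) t : tensor_ract t k%:A = k%:A *: t.
Proof.
apply: tensorP => G f fb; rewrite tlift_ract // [RHS]tlift_scale //.
apply: eq_bigr => p _; have [_ _ fm] := fb.
by rewrite ract_scalar -fm ract_scalar.
Qed.

HB.instance Definition _ := isBimodule.Build K A tensor
  tensor_ractDl tensor_ractDr tensor_ractA tensor_ract1 tensor_scale_ract
  tensor_ract_scalar.

Lemma tpure_balanced : balanced tpure.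
Proof.
split=> [y x x'|x y y'|x a y]; apply: tensorP => G f fb;
  have [fl fr fm] := fb; rewrite ?tlift_add // !tlift_pi //;
  by rewrite /tsum !big_seq1 /= ?fl ?fr ?fm.
Qed.

Lemma scale_tpure a x y : a *: tpure x y = tpure (a *: x) y.
Proof.
apply: tensorP => G f fb; rewrite [LHS]tlift_scale // !tlift_pi //.
  by rewrite /tsum !big_seq1.
exact: balancedZ.
Qed.

Lemma ract_tpure x y a : ract (tpure x y) a = tpure x (ract y a).
Proof.
apply: tensorP => G f fb; rewrite [LHS]tlift_ract // !tlift_pi //.
  by rewrite /tsum !big_seq1.
exact: balancedR.
Qed.

Lemma tensor_sum (t : tensor) : t = tsum tpure (repr t).
Proof.
apply: tensorP => G f fb.
have H s : tlift f (tsum tpure s) = tsum f s.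
  elim: s => [|p s IH]; first by rewrite /tsum !big_nil; exact: tlift0.
  rewrite /tsum !big_cons [LHS]tlift_add // -/(tsum _ _) IH; congr (_ + _).
  by rewrite tlift_pi // /tsum big_seq1.
by rewrite H.
Qed.

Lemma tliftE (G : zmodType) (f : M -> N -> G) x y :
  balanced f -> tlift f (tpure x y) = f x y.
Proof. by move=> fb; rewrite tlift_pi // /tsum big_seq1. Qed.

Lemma tliftD (G : zmodType) (f : M -> N -> G) :
  balanced f -> {morph tlift f : t u / t + u}.
Proof. by move=> fb t u; exact: tlift_add. Qed.

Lemma tlift_unique (G : zmodType) (f : M -> N -> G) (h : tensor -> G) :
  {morph h : t u / t + u} -> (forall x y, h (tpure x y) = f x y) ->
  h =1 tlift f.
Proof.
move=> hD hE t; rewrite [in LHS](tensor_sum t) /tlift.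
elim: (repr t) => [|p s IH].
  by rewrite /tsum !big_nil; apply: (addrI (h 0)); rewrite -hD !addr0.
by rewrite /tsum !big_cons hD hE -/(tsum tpure s) IH.
Qed.

End Construction.
End Tensor.

Notation "M ⊗ N" := (tensor M N)
  (at level 40, left associativity) : type_scope.
Notation "x ⊠ y" := (tpure x y)
  (at level 40, left associativity) : ring_scope.

Section Geometry.
Variables (K : comNzRingType) (A : algType K).

(* [f] and [g] are meant to be right, resp. left, [A]-linear. *)
Definition tmap (M M' N N' : bimodType A) (f : M -> M') (g : N -> N') :
    M ⊗ N -> M' ⊗ N' :=
  tlift (fun x y => f x ⊠ g y).

Definition tassoc (M N P : bimodType A) : M ⊗ (N ⊗ P) -> (M ⊗ N) ⊗ P :=
  tlift (fun x => tlift (fun y z => (x ⊠ y) ⊠ z)).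

Definition tunitl (M : bimodType A) : A^o ⊗ M -> M :=
  tlift (fun (a : A^o) x => (a : A) *: x).

Definition first_order_calculus (Om : bimodType A) (d : A -> Om) : Prop :=
  [/\ {morph d : a b / a + b},
      forall (k : K) a, d (k *: a) = k%:A *: d a,
      forall a b, d (a * b) = ract (d a) b + a *: d b
    & forall w, exists r : seq (A * A), w = \sum_(p <- r) p.1 *: d p.2].

Definition central_basis (M : bimodType A) (n : nat) (b : 'I_n -> M) : Prop :=
  (forall a i, a *: b i = ract (b i) a) /\
  (forall x, exists! c : {ffun 'I_n -> A}, x = \sum_i c i *: b i).

(* Left coefficients in a basis [b], and [0] if there are none. *)
Definition coef (M : bimodType A) (n : nat) (b : 'I_n -> M) (x : M) :
    {ffun 'I_n -> A} :=
  xget [ffun=> 0] [set c : {ffun 'I_n -> A} | x = \sum_i c i *: b i].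

Lemma coefE (M : bimodType A) (n : nat) (b : 'I_n -> M) (x : M) :
  central_basis b -> x = \sum_i coef b x i *: b i.
Proof.
by case=> _ /(_ x)[c [xc _]]; rewrite /coef; case: xgetP => [? _ //|/(_ c)].
Qed.

Lemma coef_sum (M : bimodType A) (n : nat) (b : 'I_n -> M) (c : 'I_n -> A) j :
  central_basis b -> coef b (\sum_i c i *: b i) j = c j.
Proof.
move=> bb; set x := \sum_i _; have := coefE x bb.
have [_ /(_ x)[c0 [_ c0u]]] := bb.
move=> /c0u <-; rewrite (c0u [ffun i => c i]) ?ffunE //.
by apply: eq_bigr => i _; rewrite ffunE.
Qed.

Definition partial (Om : bimodType A) (d : A -> Om) (n : nat) (s : 'I_n -> Om)
    (i : 'I_n) (a : A) : A :=
  coef s (d a) i.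

(* [ip] is the inverse of [g]: writing [g] as a sum of [x ⊠ y],
   [(w, x) y = w = x (y, w)] for all [w]. *)
Definition quantum_metric (Om : bimodType A)
    (g : Om ⊗ Om) (ip : Om ⊗ Om -> A^o) : Prop :=
  [/\ bimodule_map ip,
      forall w, tlift (fun x y => (ip (w ⊠ x) : A) *: y) g = w
    & forall w, tlift (fun x y => ract x (ip (y ⊠ w) : A)) g = w].

Definition bimodule_connection (Om M : bimodType A) (d : A -> Om)
    (nabla : M -> Om ⊗ M) (sigma : M ⊗ Om -> Om ⊗ M) : Prop :=
  [/\ {morph nabla : x y / x + y},
      bimodule_map sigma,
      forall a x, nabla (a *: x) = a *: nabla x + d a ⊠ x
    & forall x a, nabla (ract x a) = ract (nabla x) a + sigma (x ⊠ d a)].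

(* [nabla (x) id + (sigma (x) id) (id (x) nablaM)] on [Om ⊗ M]: the two
   summands are not separately well defined over [(x)_A], but the sum is, see
   [tensor_connection_balanced]. *)
Definition tensor_connection (Om M : bimodType A)
    (nabla : Om -> Om ⊗ Om) (sigma : Om ⊗ Om -> Om ⊗ Om)
    (nablaM : M -> Om ⊗ M) : Om ⊗ M -> (Om ⊗ Om) ⊗ M :=
  tlift (fun w x =>
    nabla w ⊠ x + tmap sigma idfun (tassoc (w ⊠ nablaM x))).

Definition laplacian (Om : bimodType A) (d : A -> Om)
    (ip : Om ⊗ Om -> A^o) (nabla : Om -> Om ⊗ Om) (a : A) : A :=
  ip (nabla (d a)).

Definition spinor_laplacian (Om M : bimodType A)
    (ip : Om ⊗ Om -> A^o)
    (nabla : Om -> Om ⊗ Om) (sigma : Om ⊗ Om -> Om ⊗ Om)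
    (nablaM : M -> Om ⊗ M) (x : M) : M :=
  tunitl (tmap ip idfun (tensor_connection nabla sigma nablaM (nablaM x))).

Lemma tmap_balanced (M M' N N' : bimodType A) (f : M -> M') (g : N -> N') :
  bimodule_map f -> bimodule_map g ->
  balanced (fun x y => f x ⊠ g y : M' ⊗ N').
Proof.
have [tl tr tm] := tpure_balanced M' N'.
move=> [fD _ fR] [gD gL _]; split=> [y x x'|x y y'|x a y].
- by rewrite fD tl.
- by rewrite gD tr.
- by rewrite fR tm gL.
Qed.

Lemma tassoc_balanced1 (M N P : bimodType A) (x : M) :
  balanced (fun (y : N) (z : P) => (x ⊠ y) ⊠ z).
Proof.
have [tl tr tm] := tpure_balanced M N.
have [ul ur um] := tpure_balanced (M ⊗ N) P.
split=> [z y y'|y z z'|y a z]; rewrite ?tr ?ul ?ur //.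
by rewrite -ract_tpure um.
Qed.

Lemma tassoc_balanced (M N P : bimodType A) :
  balanced (fun (x : M) => tlift (fun (y : N) (z : P) => (x ⊠ y) ⊠ z)).
Proof.
have [tl tr tm] := tpure_balanced M N.
have [ul ur um] := tpure_balanced (M ⊗ N) P.
split=> [t x x'|x t t'|x a t].
- rewrite /tlift /tsum -big_split /=; apply: eq_bigr => p _.
  by rewrite tl ul.
- by rewrite tliftD //; exact: tassoc_balanced1.
- rewrite [RHS]tlift_scale; last exact: tassoc_balanced1.
  by apply: eq_bigr => p _; rewrite tm.
Qed.

Lemma tunitl_balanced (M : bimodType A) :
  balanced (fun (a : A^o) (x : M) => (a : A) *: x).
Proof.
split=> [x a b|a x y|a b x].
- exact: scalerDl.
- exact: scalerDr.
- by rewrite scalerA.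
Qed.

Lemma tassocE (M N P : bimodType A) (x : M) (y : N) (z : P) :
  tassoc (x ⊠ (y ⊠ z)) = (x ⊠ y) ⊠ z.
Proof.
rewrite /tassoc tliftE; last exact: tassoc_balanced.
by rewrite tliftE //; exact: tassoc_balanced1.
Qed.

Lemma tensor_connection_balanced (Om M : bimodType A) (d : A -> Om)
    (nabla : Om -> Om ⊗ Om) (sigma : Om ⊗ Om -> Om ⊗ Om)
    (nablaM : M -> Om ⊗ M) (sigmaM : M ⊗ Om -> Om ⊗ M) :
  bimodule_connection d nabla sigma ->
  bimodule_connection d nablaM sigmaM ->
  balanced (fun w x =>
    nabla w ⊠ x + tmap sigma idfun (tassoc (w ⊠ nablaM x))).
Proof.
move=> [nD sB _ nR] [mD _ mL _].
have idB : bimodule_map (idfun : M -> M) by [].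
have mapD := tliftD (tmap_balanced sB idB).
have assD := tliftD (@tassoc_balanced Om Om M).
have [tl tr tm] := tpure_balanced Om (Om ⊗ M).
have [ul ur um] := tpure_balanced (Om ⊗ Om) M.
split=> [x w w'|w x x'|w a x].
- rewrite nD ul tl /tassoc assD /tmap mapD !addrA; congr (_ + _).
  by rewrite -!addrA; congr (_ + _); rewrite addrC.
- rewrite mD ur tr /tassoc assD /tmap mapD !addrA; congr (_ + _).
  by rewrite -!addrA; congr (_ + _); rewrite addrC.
- rewrite nR mL ul um tr tm /tassoc assD -/(@tassoc Om Om M) tassocE.
  rewrite /tmap mapD tliftE; last exact: tmap_balanced.
  by rewrite -!addrA; congr (_ + _); rewrite addrC.
Qed.

End Geometry.

(* Main.v *)
Require Import Defs.
From HB Require Import structures.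
From mathcomp Require Import all_boot all_order all_algebra.
From mathcomp Require Import reals complex.

Set Implicit Arguments.
Unset Strict Implicit.
Unset Printing Implicit Defensive.

Import GRing.Theory.
Local Open Scope ring_scope.

(** The spinor Laplacian is a composite [P (nablaS psi)], where the divergence
    [P : Om ⊗ Sp -> Sp] applies the tensor product connection and contracts the
    two one-forms with the inverse metric.  On a pure tensor it is
    [P (w ⊠ x) = ip (nabla w) x + <w, nablaS x>], the bracket being the
    contraction through [ip \o sigma] ([divergenceE]).  Everything follows from
    the second order Leibniz rule ([spinor_laplacian_scale])
    [boxS (a x) = a boxS x + (box a) x + <d a, nablaS x>_ip
       + <d a, nablaS x>_(ip \o sigma)]:
    writing [nablaS (a x) = a nablaS x + d a ⊠ x], one cross term comes from
    differentiating the coefficient [a] of [a nablaS x] ([divergence_scale]),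
    the other from differentiating [x] in [d a ⊠ x], where the new one-form has
    to be braided past [d a] by [sigma].

    Summing the rule over [psi = \sum psi_be e_be] gives the first formula, the
    two contractions contributing the coefficients [g^ij] and
    [g^kl sigma^ij_kl].  Because the [s i] commute with [A], such contractions
    can be read off in coordinates, in the order in which the coefficients
    occur ([bilinear_coord], [contract_coord]).

    The two explicit formulas are one computation: [ip (nabla (\sum c_j s_j))],
    given by [ip_nabla_coord], is [box a] when [c_j = partial_j a], and it is
    the part of [L] linear in [S] when [c_j = S^al_(j be)]; the quadratic part
    is the bracket [<w, nablaS e_ga>]. *)

(** * Additive maps, coordinates and tensor products *)

Lemma additive_sum (U V : zmodType) (f : U -> V) (I : Type) (r : seq I)
    (F : I -> U) :
  {morph f : x y / x + y} -> f (\sum_(i <- r) F i) = \sum_(i <- r) f (F i).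
Proof.
move=> fD; apply: (big_morph f fD).
by apply: (addrI (f 0)); rewrite -fD !addr0.
Qed.

Section Bimodules.
Variables (K : comNzRingType) (A : algType K).

Lemma tensor_ind (M N : bimodType A) (P : M ⊗ N -> Prop) :
  P 0 -> (forall x y, P (x ⊠ y)) ->
  (forall t u, P t -> P u -> P (t + u)) -> forall t, P t.
Proof. by move=> P0 Pp PD t; rewrite [t]tensor_sum; apply: big_ind. Qed.

Lemma coef_add (M : bimodType A) (n : nat) (b : 'I_n -> M) i :
  central_basis b -> {morph (fun x => coef b x i) : x y / x + y}.
Proof.
move=> bb x y /=; rewrite {1}(Defs.coefE x bb) {1}(Defs.coefE y bb) -big_split /=.
under eq_bigr do rewrite -scalerDl.
by rewrite Defs.coef_sum.
Qed.

Lemma coef_scale (M : bimodType A) (n : nat) (b : 'I_n -> M) a x i :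
  central_basis b -> coef b (a *: x) i = a * coef b x i.
Proof.
move=> bb; rewrite {1}(Defs.coefE x bb) scaler_sumr.
under eq_bigr do rewrite scalerA.
by rewrite Defs.coef_sum.
Qed.

Lemma bimodule_map_comp (M N P : bimodType A) (f : N -> P) (h : M -> N) :
  bimodule_map f -> bimodule_map h -> bimodule_map (f \o h).
Proof.
move=> [fD fL fR] [hD hL hR]; split=> [x y|a x|x a] /=.
- by rewrite hD fD.
- by rewrite hL fL.
- by rewrite hR fR.
Qed.

Section Tmap.
Variables (M M' N N' : bimodType A) (f : M -> M') (h : N -> N').
Hypotheses (fB : bimodule_map f) (hB : bimodule_map h).

Lemma tmapD : {morph tmap f h : t u / t + u}.
Proof. exact/tliftD/tmap_balanced. Qed.

Lemma tmapE x y : tmap f h (x ⊠ y) = f x ⊠ h y.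
Proof. by rewrite /tmap tliftE //; apply: tmap_balanced. Qed.
End Tmap.

Lemma tassocD (M N P : bimodType A) : {morph @tassoc K A M N P : t u / t + u}.
Proof. exact/tliftD/tassoc_balanced. Qed.

Lemma tunitlD (M : bimodType A) : {morph @tunitl K A M : t u / t + u}.
Proof. exact/tliftD/tunitl_balanced. Qed.

Lemma tunitlE (M : bimodType A) (a : A^o) (x : M) :
  tunitl (a ⊠ x) = (a : A) *: x.
Proof. by rewrite /tunitl tliftE //; apply: tunitl_balanced. Qed.

(** * Contraction of the first two tensor factors *)

Section Contraction.
Variables (Om M : bimodType A).
Implicit Types (f : Om ⊗ Om -> A^o) (t : Om ⊗ M).

(** On pure tensors [w ⊠ (v ⊠ x)] goes to [f (w ⊠ v) x].  With [f] the inverse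
    metric or its composite with the braiding, it produces both cross terms in
    the Leibniz rule of the Laplacian. *)
Definition contract f (w : Om) t : M :=
  tunitl (tmap f idfun (tassoc (w ⊠ t))).

Section Fixed.
Variable f : Om ⊗ Om -> A^o.
Hypothesis fB : bimodule_map f.

Lemma contractDr w : {morph contract f w : t u / t + u}.
Proof.
move=> t u; have [_ tr _] := tpure_balanced Om (Om ⊗ M).
by rewrite /contract tr tassocD tmapD // tunitlD.
Qed.

Lemma contractE w v x : contract f w (v ⊠ x) = (f (w ⊠ v) : A) *: x.
Proof. by rewrite /contract tassocE tmapE // tunitlE. Qed.

Lemma contract0 w : contract f w 0 = 0.
Proof. by apply: (addrI (contract f w 0)); rewrite -contractDr !addr0. Qed.

Lemma contractZl a w t : contract f (a *: w) t = a *: contract f w t.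
Proof.
elim/tensor_ind: t => [|v x|t u IHt IHu].
- by rewrite !contract0 scaler0.
- by rewrite !contractE -scale_tpure; have [_ -> _] := fB; rewrite scalerA.
- by rewrite !contractDr IHt IHu scalerDr.
Qed.
End Fixed.

(** The composite on the left is the form in which the braided term of the
    tensor product connection appears under the inverse metric; merging
    [sigma] into the pairing makes it a single contraction. *)
Lemma contract_comp f (sigma : Om ⊗ Om -> Om ⊗ Om) w t :
  bimodule_map f -> bimodule_map sigma ->
  tunitl (tmap f idfun (tmap sigma idfun (tassoc (w ⊠ t)))) =
  contract (f \o sigma) w t.
Proof.
move=> fB sB; have fsB := bimodule_map_comp fB sB.
rewrite /contract; congr (tunitl _); move: (tassoc _) => u.
apply: (tlift_unique (h := tmap f idfun \o tmap sigma idfun)) => [v v'|v x] /=.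
  by rewrite !tmapD.
by rewrite !tmapE.
Qed.

Variables (n : nat) (s : 'I_n -> Om).
Hypothesis hs : central_basis s.

(** Centrality of the basis puts the coefficients in this order: [c] moves to
    the right of [s j], leaves the pairing by right linearity, and so stays on
    the right of the coefficients of [w]. *)
Lemma bilinear_coord f (phi : 'I_n -> 'I_n -> K) w c j :
  bimodule_map f -> (forall i j, f (s i ⊠ s j) = (phi i j)%:A) ->
  f (w ⊠ (c *: s j)) = \sum_i coef s w i * (phi i j *: c) :> A.
Proof.
move=> [fD fL fR] fE; have [tl _ _] := tpure_balanced Om Om.
rewrite {1}(Defs.coefE w hs) (additive_sum _ _ (tl _)) (additive_sum _ _ fD).
apply: eq_bigr => i _; have [-> _] := hs.
by rewrite -scale_tpure -ract_tpure fL fR fE -[phi i j *: c]mulr_algl.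
Qed.

Lemma contract_coord f (phi : 'I_n -> 'I_n -> K) w (m : nat) (e : 'I_m -> M)
    (c : 'I_n -> 'I_m -> A) :
  bimodule_map f -> (forall i j, f (s i ⊠ s j) = (phi i j)%:A) ->
  contract f w (\sum_j \sum_k c j k *: (s j ⊠ e k)) =
  \sum_k (\sum_i \sum_j coef s w i * (phi i j *: c j k)) *: e k.
Proof.
move=> fB fE; rewrite exchange_big (additive_sum _ _ (contractDr fB w)) /=.
apply: eq_bigr => k _; rewrite (additive_sum _ _ (contractDr fB w)).
rewrite exchange_big scaler_suml; apply: eq_bigr => j _.
by rewrite scale_tpure contractE // (bilinear_coord _ _ _ fB fE).
Qed.
End Contraction.

(** * The spinor Laplacian *)

Section Laplacian.
Variables (Om M : bimodType A) (d : A -> Om).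
Variables (ip : Om ⊗ Om -> A^o) (ipB : bimodule_map ip).
Variables (nabla : Om -> Om ⊗ Om) (sigma : Om ⊗ Om -> Om ⊗ Om).
Hypothesis hnabla : bimodule_connection d nabla sigma.
Variables (nablaM : M -> Om ⊗ M) (sigmaM : M ⊗ Om -> Om ⊗ M).
Hypothesis hnablaM : bimodule_connection d nablaM sigmaM.

(** The contracted covariant derivative; [spinor_laplacian] is its composite
    with [nablaM]. *)
Definition divergence (t : Om ⊗ M) : M :=
  tunitl (tmap ip idfun (tensor_connection nabla sigma nablaM t)).

Lemma ip_sigma_map : bimodule_map (ip \o sigma).
Proof. by have [_ sB _ _] := hnabla; apply: bimodule_map_comp. Qed.

Lemma divergenceD : {morph divergence : t u / t + u}.
Proof.
move=> t u; rewrite /divergence /tensor_connection.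
rewrite (tliftD (tensor_connection_balanced hnabla hnablaM)).
by rewrite tmapD // tunitlD.
Qed.

Lemma divergenceE w x :
  divergence (w ⊠ x) =
  (ip (nabla w) : A) *: x + contract (ip \o sigma) w (nablaM x).
Proof.
have [_ sB _ _] := hnabla.
rewrite /divergence /tensor_connection.
rewrite (tliftE _ _ (tensor_connection_balanced hnabla hnablaM)).
by rewrite tmapD // tunitlD tmapE // tunitlE contract_comp.
Qed.

Lemma ip_nabla_scale a w :
  ip (nabla (a *: w)) = a * (ip (nabla w) : A) + ip (d a ⊠ w) :> A.
Proof.
have [_ _ nL _] := hnabla; have [ipD ipL _] := ipB.
by rewrite nL ipD ipL.
Qed.

(** Only the summand [nabla w] of the connection differentiates a left
    coefficient, so the failure of left linearity is the unbraided
    contraction with [d a]. *)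
Lemma divergence_scale a t :
  divergence (a *: t) = a *: divergence t + contract ip (d a) t.
Proof.
elim/tensor_ind: t => [|w x|t u IHt IHu].
- have d0 : divergence 0 = 0.
    by apply: (addrI (divergence 0)); rewrite -divergenceD !addr0.
  by rewrite scaler0 d0 contract0 // scaler0 addr0.
- rewrite scale_tpure !divergenceE ip_nabla_scale contractE //.
  rewrite (contractZl ip_sigma_map) scalerDl scalerDr scalerA.
  by rewrite -!addrA; congr (_ + _); rewrite addrC.
- by rewrite scalerDr !divergenceD IHt IHu contractDr // scalerDr addrACA.
Qed.

Let boxM := spinor_laplacian ip nabla sigma nablaM.

Lemma spinor_laplacianD : {morph boxM : x y / x + y}.
Proof.
have [nD _ _ _] := hnablaM => x y.
by rewrite /boxM /spinor_laplacian nD; apply: divergenceD.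
Qed.

(** The second order Leibniz rule.  The unbraided cross term is the defect of
    [divergence_scale] on [a *: nablaM x]; the braided one and
    [laplacian a *: x] are the divergence of [d a ⊠ x]. *)
Lemma spinor_laplacian_scale a x :
  boxM (a *: x) =
  a *: boxM x + (laplacian d ip nabla a *: x
    + (contract ip (d a) (nablaM x) + contract (ip \o sigma) (d a) (nablaM x))).
Proof.
have [_ _ nL _] := hnablaM.
rewrite /boxM /spinor_laplacian nL [LHS]divergenceD divergence_scale.
rewrite divergenceE /laplacian -!addrA; congr (_ + _).
by rewrite addrCA.
Qed.

Variables (n : nat) (s : 'I_n -> Om) (hs : central_basis s).
Variables (gup : 'I_n -> 'I_n -> K).
Hypothesis hgup : forall i j, ip (s i ⊠ s j) = (gup i j)%:A.
Variables (sig : 'I_n -> 'I_n -> 'I_n -> 'I_n -> K).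
Hypothesis hsig : forall i j, sigma (s i ⊠ s j) =
  \sum_k \sum_l (sig i j k l)%:A *: (s k ⊠ s l).
Variables (C : 'I_n -> 'I_n -> 'I_n -> A).
Hypothesis hC : forall j, nabla (s j) = \sum_k \sum_l C j k l *: (s k ⊠ s l).

Lemma ip_coord (c : 'I_n -> 'I_n -> A) :
  ip (\sum_k \sum_l c k l *: (s k ⊠ s l)) =
  \sum_k \sum_l gup k l *: c k l :> A.
Proof.
have [ipD ipL _] := ipB; rewrite (additive_sum _ _ ipD).
apply: eq_bigr => k _; rewrite (additive_sum _ _ ipD).
by apply: eq_bigr => l _; rewrite ipL hgup -[RHS]mulr_algr.
Qed.

(** Serves both explicit formulas: [c] is the gradient of an algebra element
    for the scalar Laplacian, a column of the spin connection for [L]. *)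
Lemma ip_nabla_coord (c : 'I_n -> A) :
  ip (nabla (\sum_j c j *: s j)) =
  \sum_i \sum_j gup i j *: partial d s i (c j)
  + \sum_j \sum_k \sum_l c j * (gup k l *: C j k l) :> A.
Proof.
have [nD _ _ _] := hnabla; have [ipD _ _] := ipB.
rewrite (additive_sum _ _ nD) (additive_sum _ _ ipD).
rewrite [X in X + _]exchange_big -big_split; apply: eq_bigr => j _ /=.
rewrite ip_nabla_scale hC ip_coord [LHS]addrC -[in ip (_ ⊠ _)](scale1r (s j)).
rewrite (bilinear_coord hs _ _ _ ipB hgup) mulr_sumr; congr (_ + _).
  by apply: eq_bigr => i _; rewrite mulr_algr.
by apply: eq_bigr => k _; rewrite mulr_sumr.
Qed.

Lemma ip_sigma_coord i j :
  ip (sigma (s i ⊠ s j)) = (\sum_k \sum_l gup k l * sig i j k l)%:A.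
Proof.
rewrite hsig ip_coord scaler_suml; apply: eq_bigr => k _.
by rewrite scaler_suml; apply: eq_bigr => l _; rewrite scalerA.
Qed.

Variables (m : nat) (e : 'I_m -> M) (he : central_basis e).
Variable (S : 'I_m -> 'I_n -> 'I_m -> A).
Hypothesis hS : forall al, nablaM (e al) =
  \sum_i \sum_be S al i be *: (s i ⊠ e be).

Lemma coef_spinor_laplacian psi al :
  coef e (boxM psi) al =
    laplacian d ip nabla (coef e psi al)
    + \sum_be coef e psi be * coef e (boxM (e be)) al
    + \sum_be \sum_i \sum_j partial d s i (coef e psi be)
        * ((gup i j + \sum_k \sum_l gup k l * sig i j k l) *: S be j al).
Proof.
rewrite {1}(Defs.coefE psi he) (additive_sum _ _ spinor_laplacianD).
under eq_bigr do rewrite spinor_laplacian_scale.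
rewrite !big_split /= !(coef_add _ he).
rewrite [coef _ (\sum_i laplacian _ _ _ _ *: _) _]Defs.coef_sum // addrCA -addrA.
congr (_ + (_ + _)).
  rewrite (additive_sum _ _ (coef_add al he)).
  by apply: eq_bigr => be _; rewrite coef_scale.
rewrite !(additive_sum _ _ (coef_add al he)) -big_split; apply: eq_bigr => be _.
rewrite hS (contract_coord hs _ _ _ ipB hgup).
rewrite (contract_coord hs _ _ _ ip_sigma_map ip_sigma_coord) !Defs.coef_sum //=.
rewrite -big_split; apply: eq_bigr => i _ /=.
rewrite -big_split; apply: eq_bigr => j _ /=.
by rewrite scalerDl mulrDr.
Qed.

Lemma coef_spinor_laplacian_basis al be :
  coef e (boxM (e al)) be =
    \sum_i \sum_j gup i j *: partial d s i (S al j be)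
    + \sum_j \sum_k \sum_l S al j be * (gup k l *: C j k l)
    + \sum_i \sum_j \sum_k \sum_l \sum_ga
        (gup k l * sig i j k l) *: (S al i ga * S ga j be).
Proof.
have [tl _ _] := tpure_balanced Om M.
(* Grouping the one-forms in front of each [e ga] makes [nablaM (e al)] a sum
   of pure tensors, to which [divergenceE] applies. *)
have -> : boxM (e al) = \sum_ga divergence ((\sum_i S al i ga *: s i) ⊠ e ga).
  rewrite -(additive_sum _ _ divergenceD) /boxM /spinor_laplacian hS.
  rewrite exchange_big /=; congr (divergence _); apply: eq_bigr => ga _.
  rewrite (additive_sum _ _ (tl _)).
  by apply: eq_bigr => i _; rewrite scale_tpure.
under eq_bigr => ga do rewrite divergenceE ip_nabla_coord.
rewrite big_split (coef_add _ he) /= Defs.coef_sum //; congr (_ + _).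
rewrite (additive_sum _ _ (coef_add be he)).
under [LHS]eq_bigr => ga _.
  rewrite hS (contract_coord hs _ _ _ ip_sigma_map ip_sigma_coord) Defs.coef_sum //.
  over.
rewrite [LHS]exchange_big; apply: eq_bigr => i _ /=.
rewrite [LHS]exchange_big; apply: eq_bigr => j _ /=.
under [LHS]eq_bigr => ga _.
  rewrite Defs.coef_sum // scaler_suml mulr_sumr.
  under eq_bigr do rewrite scaler_suml mulr_sumr.
  over.
rewrite [LHS]exchange_big; apply: eq_bigr => k _ /=.
rewrite [LHS]exchange_big; apply: eq_bigr => l _ /=.
by apply: eq_bigr => ga _; rewrite scalerAr.
Qed.
End Laplacian.
End Bimodules.

Theorem proposition2p1 (R : realType) (A : algType R[i])
    (centreA : forall z : A, (forall a, a * z = z * a) ->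
       exists c : R[i], z = c%:A)
    (* first order calculus, with a central basis *)
    (Om : bimodType A) (d : A -> Om) (hd : first_order_calculus d)
    (n : nat) (s : 'I_n -> Om) (hs : central_basis s)
    (* quantum metric *)
    (g : Om ⊗ Om) (ip : Om ⊗ Om -> A^o) (hg : quantum_metric g ip)
    (gdown : 'M[R[i]]_n) (hgdown : g = \sum_i \sum_j (gdown i j)%:A *: (s i ⊠ s j))
    (gup : 'M[R[i]]_n) (hgup : forall i j, ip (s i ⊠ s j) = (gup i j)%:A)
    (* bimodule connection on [Om] *)
    (nabla : Om -> Om ⊗ Om) (sigma : Om ⊗ Om -> Om ⊗ Om)
    (hnabla : bimodule_connection d nabla sigma)
    (Gam : 'I_n -> 'I_n -> 'I_n -> A)
    (hGam : forall i, nabla (s i) =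
       \sum_j \sum_k (- (2^-1 *: Gam i j k)) *: (s j ⊠ s k))
    (sig : 'I_n -> 'I_n -> 'I_n -> 'I_n -> R[i])
    (hsig : forall i j, sigma (s i ⊠ s j) =
       \sum_k \sum_l (sig i j k l)%:A *: (s k ⊠ s l))
    (* bimodule connection on [Sp], with a central basis *)
    (Sp : bimodType A) (m : nat) (e : 'I_m -> Sp) (he : central_basis e)
    (nablaS : Sp -> Om ⊗ Sp) (sigmaS : Sp ⊗ Om -> Om ⊗ Sp)
    (hnablaS : bimodule_connection d nablaS sigmaS)
    (S : 'I_m -> 'I_n -> 'I_m -> A)
    (hS : forall al, nablaS (e al) =
       \sum_i \sum_be S al i be *: (s i ⊠ e be)) :
  let dd := partial d s in
  let box := laplacian d ip nabla in
  let boxS := spinor_laplacian ip nabla sigma nablaS in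
  let L al be := coef e (boxS (e al)) be in
  [/\ forall (psi : Sp) al,
        let psi_ be := coef e psi be in
        coef e (boxS psi) al =
          box (psi_ al) + \sum_be psi_ be * L be al
          + \sum_be \sum_i \sum_j
              dd i (psi_ be)
              * ((gup i j + \sum_k \sum_l gup k l * sig i j k l)
                 *: S be j al),
      forall a, box a = ip (nabla (\sum_j dd j a *: s j)),
      forall a, box a =
          \sum_i \sum_j gup i j *: dd i (dd j a)
          - 2^-1 *: \sum_j \sum_k \sum_l dd j a * (gup k l *: Gam j k l)
    & forall al be, L al be =
          \sum_i \sum_j gup i j *: dd i (S al j be)
          - 2^-1 *: \sum_j \sum_k \sum_l S al j be * (gup k l *: Gam j k l)
          + \sum_i \sum_j \sum_k \sum_l \sum_ga
              (gup k l * sig i j k l) *: (S al i ga * S ga j be)].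
Proof.
have [ipB _ _] := hg.
pose C j k l : A := - (2^-1 *: Gam j k l).
have christoffelE (c : 'I_n -> A) :
    \sum_j \sum_k \sum_l c j * (gup k l *: C j k l) =
    - (2^-1 *: \sum_j \sum_k \sum_l c j * (gup k l *: Gam j k l)).
  rewrite scaler_sumr -sumrN; apply: eq_bigr => j _.
  rewrite scaler_sumr -sumrN; apply: eq_bigr => k _.
  rewrite scaler_sumr -sumrN; apply: eq_bigr => l _.
  rewrite /C scalerN mulrN; congr (- _).
  by rewrite scalerA mulrC -scalerA -scalerAr.
move=> dd box boxS L; split=> [psi al|a|a|al be].
- exact: (coef_spinor_laplacian ipB hnabla hnablaS hs hgup hsig he hS).
- by rewrite /box /laplacian {1}(Defs.coefE (d a) hs).
- rewrite /box /laplacian {1}(Defs.coefE (d a) hs).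
  by rewrite (ip_nabla_coord ipB hnabla hs hgup hGam) christoffelE.
- rewrite /L (coef_spinor_laplacian_basis ipB hnabla hnablaS hs hgup hsig hGam he hS).
  by rewrite christoffelE.
Qed.
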